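(* Let $J:\mathcal{X}\to[0,\infty]$ be a convex one-homogeneous functional. 1. For any $u\in\mathcal{X}$ and any $v\in\mathcal{X}$ with $\lambda_v v\in\partial J(v)$, $\lambda_v>0$, $\|v\|>0$, $$[u,v]_J^{\lambda_v v}=0\quad\text{if and only if}\quad\langle u,v\rangle=0.$$ 2. Let $u,v\in\mathcal{X}$ with $\lambda_u u\in\partial J(u)$, $\lambda_v v\in\partial J(v)$, $\lambda_u,\lambda_v>0$, $\|u\|,\|v\|>0$. Then the following statements are equivalent: (a) $[u,v]_J^{\lambda_v v}=0$; (b) $[v,u]_J^{\lambda_u u}=0$; (c) $\lfloor u,v\rfloor_J^{\lambda_v v}=0$; (d) $\lfloor v,u\rfloor_J^{\lambda_u u}=0$; (e) $\lfloor u,v\rfloor_J^{\lambda_v v}+\lfloor v,u\rfloor_J^{\lambda_u u}=0$; (f) $\langle u,v\rangle=0$.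
   Context: $\mathcal{X}$ is a real Banach space of functions with dual $\mathcal{X}^*$; $\langle\cdot,\cdot\rangle$ denotes the $L^2$ inner product and $\|\cdot\|$ the $L^2$ norm; the $L^2$ inner product is used as the pairing between $\mathcal{X}$ and $\mathcal{X}^*$ (so a function $\lambda u$ is regarded as an element of $\mathcal{X}^*$ through $w\mapsto\lambda\langle u,w\rangle$). $J:\mathcal{X}\to[0,\infty]$ is proper, convex and lower semi-continuous. One-homogeneous means $J(\alpha u)=|\alpha|J(u)$ for all $\alpha\in\mathbb{R}$, $u\in\mathcal{X}$. It is assumed throughout that $J(u)>0$ for $u\in\mathcal{X}\setminus\{0\}$. The subdifferential is $\partial J(u)=\{p\in\mathcal{X}^* : J(v)-J(u)\ge\langle p,v-u\rangle\ \forall v\in\mathcal{X}\}$. For $p\in\partial J(v)$, the semi-inner-product and the semi-inner-product of degree $1/2$ with respect to the chosen subgradient are $$[u,v]_J^{p}:=\langle u,p\rangle J(v),\qquad \lfloor u,v\rfloor_J^{p}:=\langle u,p\rangle;$$ the superscript $\lambda_v v$ means that the subgradient $p=\lambda_v v\in\partial J(v)$ is chosen (and similarly for $\lambda_u u\in\partial J(u)$). *)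

(* Defs.v *)
(* MathComp-Analysis *)
From HB Require Import structures.
From mathcomp Require Import all_boot all_order all_algebra.
From mathcomp Require Import all_classical all_reals all_analysis.

Set Implicit Arguments.
Unset Strict Implicit.
Unset Printing Implicit Defensive.

Import Order.TTheory GRing.Theory Num.Theory.
Import numFieldNormedType.Exports.

Local Open Scope classical_set_scope.
Local Open Scope ring_scope.

Section FunctionSpace.
Context {d : measure_display} {Omega : measurableType d} {R : realType}.
Variable mu : {measure set Omega -> \bar R}.
Context {X : completeNormedModType R}.
Variable rep : X -> {mfun Omega >-> R}.

(* A Banach space of (classes of) functions: [rep u] is a measurable
   representative of u, and the vector operations and the equality of X are
   those of functions modulo mu-a.e. equality.  The norm of X is unrelated to
   the L^2 norm, and X is not required to be included in L^2. *)
Definition function_space : Prop :=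
  (forall (a : R) (u v : X),
     rep (a *: u + v) = (a *: rep u + rep v : {mfun Omega >-> R}) %[ae mu]) /\
  (forall u v : X, rep u = rep v %[ae mu] -> u = v).

Definition L2inner (u v : X) : R := \int[mu]_x (rep u x * rep v x).

Definition L2norm (u : X) : \bar R := 'N[mu]_(2%:E)[EFin \o rep u].

(* The functional p on X is the function l u, i.e., w |-> l <u, w>. Since
   Rintegral is total, we require that this pairing make sense on all of X. *)
Definition is_scaled_fun (p : {linear X -> R^o}) (l : R) (u : X) : Prop :=
  forall w : X, mu.-integrable setT (fun x => (rep u x * rep w x)%:E) /\
    p w = l * L2inner u w.

End FunctionSpace.

Section Functional.
Context {R : realType} {X : completeNormedModType R}.
Implicit Types (J : X -> \bar R) (u v : X) (p : {linear X -> R^o}).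
Local Open Scope ereal_scope.

Definition proper_functional J : Prop := exists u, J u < +oo.

Definition convex_functional J : Prop :=
  forall (t : R) u v, (0 <= t <= 1)%R ->
    J (t *: u + (1 - t) *: v)%R <= t%:E * J u + (1 - t)%:E * J v.

(* With the convention 0 * +oo = 0 this contains J 0 = 0. *)
Definition one_homogeneous J : Prop :=
  forall (a : R) u, J (a *: u)%R = `|a|%:E * J u.

(* The continuous linear forms p are the elements of X^*. If J u = +oo then
   J v - J u = -oo for all v, so that the subdifferential is empty outside of
   the domain of J. *)
Definition subdifferential J u : set {linear X -> R^o} :=
  [set p | continuous p /\
    forall v, (p (v - u)%R : R)%:E <= J v - J u].

(* [u, v]_J^p, where p is the chosen element of subdifferential J v *)
Definition semi_inner J u v p : \bar R := (p u : R)%:E * J v.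

(* |_u, v_|_J^p: the second argument v only acts through the choice of
   p in subdifferential J v *)
Definition half_semi_inner J u v p : R := p u.

End Functional.

(* Main.v *)
Require Import Defs.
From HB Require Import structures.
From mathcomp Require Import all_boot all_order all_algebra.
From mathcomp Require Import all_classical all_reals all_analysis.
From mathcomp Require Import measurable_realfun.
Import Order.TTheory GRing.Theory Num.Theory.
Import numFieldNormedType.Exports.
Local Open Scope classical_set_scope.
Local Open Scope ring_scope.

(** If [lv v] is a subgradient of [J] at [v], then for every [u] the pairing of
    [u] with this subgradient is [lv <u, v>].  Since [lv <> 0], it vanishes
    exactly when [<u, v> = 0], and the symmetry of the inner product lets [u]
    and [v] be exchanged.  For the sum of the two half semi-inner products this
    gives [(lu + lv) <u, v>]; here positivity of the multipliers matters,
    because it excludes [lu + lv = 0].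

    The degree-one semi-inner product carries the additional factor [J v].  It
    is positive because [v] has positive [L^2] norm and hence is not zero
    ([L2norm_gt0_neq0]), and a product with a positive extended real vanishes
    only if the other factor does. *)

Section FunctionSpace.
Context {R : realType} {d : measure_display} {Omega : measurableType d}.
Context {mu : {measure set Omega -> \bar R}}.
Context {X : completeNormedModType R} {rep : X -> {mfun Omega >-> R}}.

Lemma L2innerC (u v : X) : L2inner mu rep u v = L2inner mu rep v u.
Proof. by rewrite /L2inner; under eq_Rintegral do rewrite mulrC. Qed.

Lemma function_space_rep0 : function_space mu rep ->
  (rep 0 : Omega -> R) = cst 0 %[ae mu].
Proof.
move=> [rep_lin _]; have := rep_lin (-1) 0 0.
(* Almost everywhere rep 0 = - rep 0 + rep 0. *)
rewrite scaler0 addr0; apply: filterS => x rep0E xT.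
by rewrite (rep0E xT) /= scaleN1r addNr.
Qed.

(** Representatives respect the vector operations only almost everywhere, so
    [rep 0] need not be the zero function; its [L^2] norm still vanishes. *)
Lemma L2norm0 : function_space mu rep -> L2norm mu rep 0 = 0%E.
Proof.
move=> /function_space_rep0 rep0; rewrite /L2norm.
rewrite -(Lnorm0 mu (p := 2%:E)); last by rewrite eqe pnatr_eq0.
rewrite unlock /=; congr (_ `^ _)%E.
apply: ae_eq_integral => //.
- apply/measurable_EFinP/(measurableT_comp (measurable_powR _)).
  exact: measurableT_comp.
- by apply: filterS rep0 => x rep0x xT /=; rewrite (rep0x xT).
Qed.

Lemma L2norm_gt0_neq0 {v : X} : function_space mu rep ->
  (0 < L2norm mu rep v)%E -> v <> 0.
Proof. by move=> Xfun + v0; rewrite v0 L2norm0 // ltxx. Qed.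

Lemma scaled_fun_eq0 (J : X -> \bar R) (u : X) {v : X} {l : R}
    {p : {linear X -> R^o}} :
  is_scaled_fun mu rep p l v -> 0 < l ->
  half_semi_inner J u v p = 0 <-> L2inner mu rep u v = 0.
Proof.
move=> /(_ u)[_ pE] l_gt0; rewrite /half_semi_inner pE L2innerC.
split=> [/eqP|->]; last by rewrite mulr0.
by rewrite mulf_eq0 gt_eqF //= => /eqP.
Qed.

End FunctionSpace.

Lemma semi_inner_eq0 (R : realType) (X : completeNormedModType R)
    (J : X -> \bar R) (u v : X) (p : {linear X -> R^o}) :
  (0 < J v)%E ->
  semi_inner J u v p = 0%E <-> half_semi_inner J u v p = 0.
Proof.
rewrite /semi_inner /half_semi_inner => Jv_gt0.
split=> [|->]; last by rewrite mul0e.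
by move/eqP; rewrite mule_eq0 (gt_eqF Jv_gt0) orbF eqe => /eqP.
Qed.

Theorem proposition4 (R : realType) (d : measure_display)
  (Omega : measurableType d) (mu : {measure set Omega -> \bar R})
  (X : completeNormedModType R) (rep : X -> {mfun Omega >-> R})
  (Xfun : function_space mu rep)
  (J : X -> \bar R)
  (J_ge0 : forall u : X, (0 <= J u)%E)
  (J_proper : proper_functional J)
  (J_convex : convex_functional J)
  (J_lsc : lower_semicontinuous J)
  (J_hom : one_homogeneous J)
  (J_gt0 : forall u : X, u <> 0 -> (0 < J u)%E) :
  (forall (u v : X) (lv : R) (pv : {linear X -> R^o}),
     is_scaled_fun mu rep pv lv v -> subdifferential J v pv ->
     0 < lv -> (0 < L2norm mu rep v)%E ->
     semi_inner J u v pv = 0%E <-> L2inner mu rep u v = 0) /\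
  (forall (u v : X) (lu lv : R) (pu pv : {linear X -> R^o}),
     is_scaled_fun mu rep pu lu u -> subdifferential J u pu ->
     is_scaled_fun mu rep pv lv v -> subdifferential J v pv ->
     0 < lu -> 0 < lv ->
     (0 < L2norm mu rep u)%E -> (0 < L2norm mu rep v)%E ->
     [<-> semi_inner J u v pv = 0%E;
          semi_inner J v u pu = 0%E;
          half_semi_inner J u v pv = 0;
          half_semi_inner J v u pu = 0;
          half_semi_inner J u v pv + half_semi_inner J v u pu = 0;
          L2inner mu rep u v = 0]).
Proof.
have semiE (u v : X) (lv : R) (pv : {linear X -> R^o}) :
    is_scaled_fun mu rep pv lv v -> subdifferential J v pv ->
    0 < lv -> (0 < L2norm mu rep v)%E ->
    semi_inner J u v pv = 0%E <-> L2inner mu rep u v = 0.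
  move=> pvE Jpv lv_gt0 v_gt0.
  rewrite -(scaled_fun_eq0 J u pvE lv_gt0).
  exact/semi_inner_eq0/J_gt0/(L2norm_gt0_neq0 Xfun).
split=> // u v lu lv pu pv puE Jpu pvE Jpv lu_gt0 lv_gt0 u_gt0 v_gt0.
have semi_uv := semiE u v lv pv pvE Jpv lv_gt0 v_gt0.
have semi_vu := semiE v u lu pu puE Jpu lu_gt0 u_gt0.
have half_uv := scaled_fun_eq0 J u pvE lv_gt0.
have half_vu := scaled_fun_eq0 J v puE lu_gt0.
rewrite (L2innerC v u) in semi_vu half_vu.
tfae.
- by move=> /semi_uv /semi_vu.
- by move=> /semi_vu /half_uv.
- by move=> /half_uv /half_vu.
- by move=> vu0; rewrite vu0 addr0; apply/half_uv/half_vu.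
- have [_ pvu] := pvE u; have [_ puv] := puE v.
  rewrite /half_semi_inner pvu puv (L2innerC v u) -mulrDl.
  by move=> /eqP; rewrite mulf_eq0 gt_eqF ?addr_gt0 //= => /eqP.
- by move=> /semi_uv.
Qed.
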